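(* Let $X\in\mathbb{R}^{n\times d}$, $n>d$, have rank $d$, and let $\alpha\in(0,1)$ and $\varepsilon\in(0,1)$. Let $\hat\ell_1(X),\dots,\hat\ell_n(X)$ be approximate leverage scores satisfying $(1-\alpha)\ell_i(X)\le\hat\ell_i(X)\le(1+\alpha)\ell_i(X)$ for all $i=1,\dots,n$. Order the rows of $X$ so that $\hat\ell_1(X)\ge\dots\ge\hat\ell_n(X)$, put $t=\sum_{i=1}^n\hat\ell_i(X)$, and let $s$ be the smallest $j\in\{1,\dots,n\}$ such that $\sum_{i=1}^j\hat\ell_i(X)>t-(1-\alpha)\varepsilon$. If the leverage scores of $X$ exhibit a power law decay (with exponent $1+\eta$, for a fixed $\eta>0$), then $$s=\mathrm{poly}\left(d(1+\alpha),\ \frac{1}{(1-\alpha)\varepsilon}\right),$$ that is, $s$ is bounded above by a polynomial, depending only on $\eta$, in $d(1+\alpha)$ and $\frac{1}{(1-\alpha)\varepsilon}$.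
   Context: For $X\in\mathbb{R}^{n\times d}$ of rank $d$, the $i$th leverage score is $\ell_i(X)=e_i^\top X(X^\top X)^{-1}X^\top e_i$, where $e_i$ is the $i$th standard basis vector; one has $\sum_{i=1}^n\ell_i(X)=d$. The leverage scores exhibit a power law decay with exponent $1+\eta$, $\eta>0$, if, when arranged in decreasing order $\ell_{(1)}\ge\ell_{(2)}\ge\dots\ge\ell_{(n)}$, they satisfy $\ell_{(i)}=\ell_{(1)}/i^{1+\eta}$ for all $i=1,\dots,n$. *)

(* Defs.v *)
(* MathComp / MathComp-Analysis *)
From HB Require Import structures.
From mathcomp Require Import all_boot all_order all_algebra.
From mathcomp Require Import reals exp.

Set Implicit Arguments.
Unset Strict Implicit.
Unset Printing Implicit Defensive.

Import Order.TTheory GRing.Theory Num.Theory.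
Local Open Scope ring_scope.

(* The mathematical indices 1, ..., n are represented by 0, ..., n.-1 in 'I_n. *)

(* invmx is the inverse only for X^T X invertible, that is, for X of rank d. *)
Definition leverage_score (R : realType) (n d : nat) (X : 'M[R]_(n, d))
    (i : 'I_n) : R :=
  let e : 'cV[R]_n := delta_mx i 0 in
  (e^T *m X *m invmx (X^T *m X) *m X^T *m e) 0 0.

Definition sorted_leverage_scores (R : realType) (n d : nat)
    (X : 'M[R]_(n, d)) : seq R :=
  sort >=%R [seq leverage_score X i | i <- enum 'I_n].

Definition power_law_decay (R : realType) (eta : R) (n d : nat)
    (X : 'M[R]_(n, d)) : Prop :=
  let l := sorted_leverage_scores X in
  forall i : 'I_n, l`_i = l`_0 / (i.+1%:R `^ (1 + eta)).

(* s is the smallest j in {1, ..., n} such that the sum of the first j values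
   of l exceeds c. *)
Definition smallest_prefix_above (R : realType) (n : nat) (l : 'I_n -> R)
    (c : R) (s : nat) : Prop :=
  let above (j : nat) := (1 <= j <= n)%N /\ c < \sum_(i < n | (i < j)%N) l i in
  above s /\ forall j : nat, above j -> (s <= j)%N.

(* Main.v *)
(* If s = m + 1 with m >= 1, minimality of s says that the approximate scores
   beyond the m-th sum to at least (1 - alpha) eps. The i-th approximate score
   is at most (1 + alpha) l_(i) <= (1 + alpha) d / i^(1 + eta), because the
   leverage scores are nonnegative with sum d, and the tail of the series of
   i^-(1 + eta) beyond m is at most 1 / (eta m^eta). Hence m^eta <= p q / eta
   with p = d (1 + alpha) and q = 1 / ((1 - alpha) eps), and
   s <= 1 + (1 + p q / eta)^K for any natural number K >= 1 / eta. *)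
Require Import Defs.
From mathcomp Require Import all_boot all_order all_algebra.
From mathcomp Require Import reals sequences exp.
From mathcomp Require Import ring lra.

Import Order.TTheory GRing.Theory Num.Theory.
Local Open Scope ring_scope.

Lemma row_norm0_eq0 (R : realDomainType) (n : nat) (v : 'rV[R]_n) :
  v *m v^T = 0 -> v = 0.
Proof.
move=> /matrixP /(_ 0 0); rewrite !mxE => h.
have sq_ge0 j : true -> 0 <= v 0 j * v^T j 0.
  by move=> _; rewrite mxE -expr2 sqr_ge0.
apply/rowP => j; have /eqP : v 0 j * v^T j 0 = 0.
  exact: psumr_eq0P sq_ge0 h _ _.
by rewrite !mxE mulf_eq0 orbb => /eqP.
Qed.

(** If [v X^T X = 0], then [v X^T] has squared norm [v X^T X v^T = 0], so [v X^T = 0]; full rank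
    makes [X^T] row free, so [v = 0]. *)
Lemma gram_unitmx {R : realFieldType} {n d : nat} (X : 'M[R]_(n, d)) :
  \rank X = d -> X^T *m X \in unitmx.
Proof.
move=> rkX; rewrite -row_free_unit; apply: inj_row_free => v hv.
have freeXT : row_free X^T by rewrite /row_free mxrank_tr rkX.
apply/eqP; rewrite -(mulmx_free_eq0 v freeXT); apply/eqP/row_norm0_eq0.
by rewrite trmx_mul trmxK mulmxA -(mulmxA v) hv mul0mx.
Qed.

Definition hat_mx {R : realType} {n d : nat} (X : 'M[R]_(n, d)) : 'M[R]_n :=
  X *m invmx (X^T *m X) *m X^T.

Lemma leverage_scoreE {R : realType} {n d : nat} (X : 'M[R]_(n, d)) i :
  leverage_score X i = hat_mx X i i.
Proof.
rewrite /leverage_score /hat_mx -!mulmxA trmx_delta -rowE mxE.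
by rewrite !mulmxA -colE mxE.
Qed.

(* The hat matrix is an orthogonal projection, so its diagonal entries are the
   squared norms of its rows. *)
Lemma leverage_score_ge0 {R : realType} {n d : nat} (X : 'M[R]_(n, d)) i :
  \rank X = d -> 0 <= leverage_score X i.
Proof.
move=> rkX; have U := gram_unitmx X rkX.
have symH : (hat_mx X)^T = hat_mx X.
  by rewrite /hat_mx !trmx_mul trmx_inv trmx_mul !trmxK mulmxA.
have idemH : hat_mx X *m hat_mx X = hat_mx X.
  by rewrite /hat_mx !mulmxA -(mulmxA _ X^T X) mulmxKV.
rewrite leverage_scoreE -{1}idemH -{2}symH mxE sumr_ge0 // => j _.
by rewrite [_^T _ _]mxE -expr2 sqr_ge0.
Qed.

(** Cyclicity of the trace turns the hat matrix into the identity of size [d]. *)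
Lemma sum_leverage_score {R : realType} {n d : nat} (X : 'M[R]_(n, d)) :
  \rank X = d -> \sum_(i < n) leverage_score X i = d%:R.
Proof.
move=> rkX; under eq_bigr do rewrite leverage_scoreE.
rewrite -/(\tr (hat_mx X)) /hat_mx mxtrace_mulC mulmxA mulmxV ?gram_unitmx //.
exact: mxtrace1.
Qed.

Lemma leverage_score_le_dim {R : realType} {n d : nat} (X : 'M[R]_(n, d)) i :
  \rank X = d -> leverage_score X i <= d%:R.
Proof.
move=> rkX; rewrite -(sum_leverage_score X) // (bigD1 i) //= lerDl.
by apply: sumr_ge0 => j _; exact: leverage_score_ge0.
Qed.

(** If the entry at position [k] were below [v], so would be every later one, leaving at most [k]
    entries that reach [v]. *)
Lemma nth_sort_ge (R : realDomainType) (l : seq R) (v : R) (k : nat) :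
  (k < count (fun x => v <= x)%R l)%N -> v <= (sort >=%R l)`_k.
Proof.
rewrite -(count_sort >=%R) => hk.
have s_sorted : sorted >=%R (sort >=%R l).
  by apply: sort_sorted => x y; exact: le_total.
set s := sort _ _ in hk s_sorted *.
rewrite leNgt; apply/negP => lt_v; move: hk; apply/negP; rewrite -leqNgt.
rewrite -{1}(cat_take_drop k s) count_cat.
have -> : count (fun x => v <= x) (drop k s) = 0%N.
  apply/eqP; rewrite -leqn0 leqNgt -has_count; apply/hasPn => x.
  move=> /(nthP 0) [i]; rewrite size_drop nth_drop ltn_subRL => hi <-.
  rewrite -ltNge (le_lt_trans _ lt_v) //.
  have ge_tr : transitive (>=%R : rel R).
    by move=> a b c hba hcb; exact: le_trans hcb hba.
  apply: (sorted_leq_nth ge_tr (@lexx _ _) 0 s_sorted);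
    rewrite ?inE ?leq_addr //.
  exact: leq_ltn_trans (leq_addr _ _) hi.
rewrite addn0 (leq_trans (count_size _ _)) // size_take.
by case: ltnP.
Qed.

(* The first i.+1 leverage scores are all at least lhat i / c, hence so is the
   (i.+1)-st largest one. *)
Lemma approx_score_le_sorted {R : realType} {n d : nat} (X : 'M[R]_(n, d))
    (c : R) (lhat : 'I_n -> R) :
  0 < c ->
  (forall i, lhat i <= c * leverage_score X i) ->
  (forall i j : 'I_n, (i <= j)%N -> lhat j <= lhat i) ->
  forall i : 'I_n, lhat i <= c * (sorted_leverage_scores X)`_i.
Proof.
move=> c0 le_lhat mono i; rewrite -ler_pdivrMl // nth_sort_ge // count_map.
have -> : count (preim (leverage_score X) (fun x => c^-1 * lhat i <= x))
    (enum 'I_n) = #|[pred j | c^-1 * lhat i <= leverage_score X j]|.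
  by rewrite cardE -size_filter enumT; congr size; apply: eq_filter => j.
have <- : #|[pred j : 'I_n | (j < i.+1)%N]| = i.+1.
  rewrite -sum1_card -(big_ord_widen _ (fun=> 1%N)) ?ltn_ord //.
  by rewrite sum1_card card_ord.
apply: subset_leq_card; apply/subsetP => j; rewrite !inE ltnS => le_ji.
by rewrite ler_pdivrMl // (le_trans (mono _ _ le_ji)).
Qed.

(** The right-hand side is the integral of [u^-(1 + eta)] over [[x, x + 1]], whose integrand is
    smallest at [x + 1]. The proof avoids integration by factoring out [y^(- eta)]. *)
Lemma powR_le_telescope (R : realType) (eta x : R) : 0 < eta -> 0 < x ->
  ((x + 1) `^ (1 + eta))^-1 <= eta^-1 * (x `^ (- eta) - (x + 1) `^ (- eta)).
Proof.
move=> eta0 x0; have y0 : 0 < x + 1 by lra.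
set y := x + 1 in y0 *; set r := (x / y) `^ (- eta).
have -> : x `^ (- eta) = y `^ (- eta) * r.
  by rewrite -powRM ?ltW ?divr_gt0 // mulrC divfK ?gt_eqF.
(* Since [x / y = 1 - 1/y], this combines [exp z >= 1 + z] with [ln (1 + z) <= z] at [z = - 1/y]. *)
have r_ge : 1 + eta * y^-1 <= r.
  rewrite /r /powR gt_eqF ?divr_gt0 //; apply: le_trans (expR_ge1Dx _).
  rewrite lerD2l mulNr -mulrN ler_pM2l // lerNr.
  have -> : x / y = 1 + - y^-1 by rewrite /y; field; lra.
  by rewrite le_ln1Dx // ltrN2 invf_lt1 // /y; lra.
rewrite -powRN opprD powRD ?(gt_eqF y0) ?implybT // powR_inv1 ?(ltW y0) //.
have -> : y `^ (- eta) * r - y `^ (- eta) = y `^ (- eta) * (r - 1) by ring.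
rewrite mulrCA mulrC ler_pM2l ?powR_gt0 //.
by rewrite ler_pdivlMl //; lra.
Qed.

Lemma power_tail_le (R : realType) (eta : R) (m n : nat) : 0 < eta ->
  (0 < m <= n)%N ->
  \sum_(m <= i < n) (i.+1%:R `^ (1 + eta))^-1 <= eta^-1 * (m%:R `^ eta)^-1 :> R.
Proof.
move=> eta0 /andP[m0 le_mn].
(* [f] is an antiderivative of [u^-(1 + eta)]; the sum of its increments telescopes. *)
pose f i : R := - (eta^-1 * i%:R `^ (- eta)).
have -> : eta^-1 * (m%:R `^ eta)^-1 = - f m by rewrite opprK powRN.
apply: (@le_trans _ _ (f n - f m)); last first.
  by rewrite gerDr oppr_le0 mulr_ge0 ?powR_ge0 // invr_ge0 ltW.
rewrite -telescope_sumr // !big_nat ler_sum // => i /andP[le_mi _].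
have i0 : 0 < i%:R :> R by rewrite ltr0n (leq_trans m0).
have := powR_le_telescope _ _ _ eta0 i0; rewrite /f -natr1; lra.
Qed.

(** Passing from [y] to [1 + y] makes the base at least 1, so the real exponent [1 / eta] may be
    raised to the natural number [K]. *)
Lemma powR_le_natpow (R : realType) (eta x y : R) (K : nat) :
  0 < eta -> eta^-1 <= K%:R -> 0 <= x -> 0 <= y -> x `^ eta <= y ->
  x <= (1 + y) ^+ K.
Proof.
move=> eta0 leK x0 y0 le_xy.
have -> : x = (x `^ eta) `^ eta^-1.
  by rewrite -powRrM divff ?gt_eqF // powRr1.
apply: (@le_trans _ _ ((1 + y) `^ eta^-1)).
  apply: ge0_ler_powR; rewrite ?nnegrE ?powR_ge0 ?invr_ge0 ?(ltW eta0) //; lra.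
rewrite -powR_mulrn; last lra.
by apply: ler_powR => //; lra.
Qed.

Theorem corollaryB3 (R : realType) (eta : R) (heta : 0 < eta) :
  exists P : {poly {poly R}},
    forall (n d : nat) (X : 'M[R]_(n, d)) (alpha eps : R)
           (lhat : 'I_n -> R) (s : nat),
      (d < n)%N ->
      \rank X = d ->
      0 < alpha < 1 ->
      0 < eps < 1 ->
      (forall i : 'I_n,
         (1 - alpha) * leverage_score X i <= lhat i
           <= (1 + alpha) * leverage_score X i) ->
      (forall i j : 'I_n, (i <= j)%N -> lhat j <= lhat i) ->
      let t := \sum_(i < n) lhat i in
      smallest_prefix_above lhat (t - (1 - alpha) * eps) s ->
      power_law_decay eta X ->
      s%:R <= P.[d%:R * (1 + alpha), 1 / ((1 - alpha) * eps)].
Proof.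
have [K leK] : exists K : nat, eta^-1 <= K%:R.
  exists (Num.truncn eta^-1).+1; apply/ltW.
  by have /andP[] := truncn_itv (ltW (eqbRL (invr_gt0 eta) heta)).
(* The leading 1 absorbs the shift in [s = m + 1]; the product of the two variables becomes [p / e].
   Only [eta] enters the coefficients and [K]. *)
exists (1 + (1 + eta^-1%:P%:P * ('X * 'X%:P)) ^+ K).
move=> n d X alpha eps lhat s lt_dn rkX /andP[alpha0 alpha1] /andP[eps0 _].
move=> approx mono t [[/andP[s0 le_sn] _] s_min] decay.
set p := d%:R * (1 + alpha); set e := (1 - alpha) * eps.
have horner_P x y : (1 + (1 + eta^-1%:P%:P * ('X * 'X%:P)) ^+ K).[x, y]
    = 1 + (1 + eta^-1 * (x * y)) ^+ K :> R.
  by rewrite !hornerE.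
rewrite horner_P div1r; set b := eta^-1 * (p / e).
have e0 : 0 < e by rewrite mulr_gt0 ?subr_gt0.
have p0 : 0 <= p by rewrite mulr_ge0 //; lra.
have b0 : 0 <= b.
  by apply: mulr_ge0; [rewrite invr_ge0|apply: divr_ge0 => //]; exact: ltW.
case: s s0 le_sn s_min => // m _ le_mn s_min.
rewrite -nat1r lerD2l.
(* For [m = 0] minimality gives nothing, as 0 lies outside the range of admissible [j]; the leading
   1 is then enough. *)
have [->|m0] := posnP m.
  by rewrite exprn_ge0 // addr_ge0.
apply: (powR_le_natpow _ eta) => //.
have tail_ge : e <= \sum_(i < n | (m <= i)%N) lhat i.
  have /negP : ~ (t - e < \sum_(i < n | (i < m)%N) lhat i).
    move=> above; have := s_min m; rewrite ltnn => /(_ _) h.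
    by have // := h (conj (introT andP (conj m0 (ltnW le_mn))) above).
  have -> : t = \sum_(i < n | (i < m)%N) lhat i
      + \sum_(i < n | (m <= i)%N) lhat i.
    rewrite /t (bigID (fun i : 'I_n => (i < m)%N)) /=; congr (_ + _).
    by apply: eq_bigl => i; rewrite -leqNgt.
  rewrite -leNgt; lra.
(* With [n] positive, entry 0 of the sorted list is a genuine leverage score and not the default
   value of [nth]. *)
have n0 : (0 < n)%N by exact: leq_ltn_trans lt_dn.
have l0_le : (sorted_leverage_scores X)`_0 <= d%:R.
  have : (sorted_leverage_scores X)`_0 \in sorted_leverage_scores X.
    by rewrite mem_nth // size_sort size_map size_enum_ord.
  by rewrite mem_sort => /mapP[j _ ->]; exact: leverage_score_le_dim.
have tail_le : \sum_(i < n | (m <= i)%N) lhat i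
    <= p * (eta^-1 * (m%:R `^ eta)^-1).
  have m_range : (0 < m <= n)%N by rewrite m0 ltnW.
  apply: le_trans (ler_wpM2l p0 (power_tail_le _ eta m n heta m_range)).
  rewrite mulr_sumr big_geq_mkord /=.
  apply: ler_sum => i _.
  have c0 : 0 < 1 + alpha by lra.
  have le_lhat j : lhat j <= (1 + alpha) * leverage_score X j.
    by have /andP[] := approx j.
  apply: le_trans (approx_score_le_sorted X _ _ c0 le_lhat mono i) _.
  rewrite decay mulrA ler_wpM2r ?invr_ge0 ?powR_ge0 //.
  by rewrite /p mulrC ler_wpM2r // ltW.
(* Both tail bounds together give [e <= p / (eta m^eta)], which is solved for [m^eta]. *)
have := le_trans tail_ge tail_le.
have q0 : 0 < m%:R `^ eta :> R by rewrite powR_gt0 // ltr0n.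
rewrite mulrA ler_pdivlMr // mulrC -ler_pdivlMr //.
by rewrite /b mulrCA mulrA.
Qed.
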